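(* Let $X, Y$ be separable metrizable spaces and let $f : X \rightarrow Y$ be a function. Then Player II has a winning strategy in the game $G(f)$ if and only if $f$ is Baire class $1$.
   Context: A function $f:X\to Y$ between topological spaces is Baire class $1$ if for every open $V\subseteq Y$ the preimage $f^{-1}(V)$ is an $F_\sigma$ subset of $X$ (a countable union of closed subsets of $X$). Convergent sequences of open sets: a sequence $(U_n)_{n\in\mathbb{N}}$ of open subsets of a topological space $X$ is convergent if it is decreasing with respect to $\subseteq$ and it is a local basis of some $x\in X$ (i.e. $x\in U_n$ for all $n$, and every open neighborhood of $x$ contains some $U_n$); in that case we write $\lim_{n\to\infty}U_n=x$ and say it converges to $x$. The game $G(f)$: let $X,Y$ be separable metrizable spaces and $f:X\to Y$. At round $n\in\mathbb{N}$, Player I plays a nonempty open subset $U_n$ of $X$, and then Player II plays a point $y_n\in\mathrm{ran}(f)$, with the rule that $U_{n+1}\subseteq U_n$ for every $n$. Player II wins the run if either the sequence $(U_n)_{n\in\mathbb{N}}$ is not convergent, or it converges to some $x\in X$ and $(y_n)_{n\in\mathbb{N}}$ converges to $f(x)$ in $Y$; otherwise Player I wins the run. Strategies: a partial play of Player I is a nonempty finite $\subseteq$-decreasing sequence of nonempty open subsets of $X$. A strategy for Player II is a function $\sigma$ assigning to each partial play of Player I an element of $\mathrm{ran}(f)$. It is winning if for every infinite $\subseteq$-decreasing sequence $(U_n)_{n\in\mathbb{N}}$ of nonempty open subsets of $X$, Player II wins the run in which Player I plays $U_n$ and Player II plays $y_n=\sigma(U_0,\dots,U_n)$ at each round $n$.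 *)

(* Defs.v *)
From HB Require Import structures.
From mathcomp Require Import all_boot all_order all_algebra.
From mathcomp Require Import all_classical all_reals all_analysis.
From mathcomp Require Import borel_hierarchy.
Set Implicit Arguments.
Unset Strict Implicit.
Unset Printing Implicit Defensive.
Import Order.TTheory GRing.Theory Num.Theory.
Local Open Scope classical_set_scope.
Local Open Scope ring_scope.

Definition is_metric (R : realType) (T : Type) (d : T -> T -> R) : Prop :=
  [/\ forall x y, 0 <= d x y,
      forall x y, d x y = 0 <-> x = y,
      forall x y, d x y = d y x &
      forall x y z, d x z <= d x y + d y z].

Definition metrizable (R : realType) (T : topologicalType) : Prop :=
  exists d : T -> T -> R, is_metric d /\
    forall A : set T, open A <->
      forall x, A x -> exists2 e : R, 0 < e & [set y | d x y < e] `<=` A.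

Definition separable_space (T : topologicalType) : Prop :=
  exists2 D : set T, countable D & dense D.

Definition Baire_class1 (X Y : topologicalType) (f : X -> Y) : Prop :=
  forall V : set Y, open V -> Fsigma (f @^-1` V).

Definition converges_to (X : topologicalType) (U : nat -> set X) (x : X) : Prop :=
  [/\ forall n, open (U n),
      forall n, U n.+1 `<=` U n,
      forall n, U n x &
      forall V : set X, open V -> V x -> exists n, U n `<=` V].

Definition convergent (X : topologicalType) (U : nat -> set X) : Prop :=
  exists x, converges_to U x.

Definition play (X : topologicalType) (U : nat -> set X) : Prop :=
  forall n, [/\ open (U n), U n !=set0 & U n.+1 `<=` U n].

Definition partial_play (X : topologicalType) : set (seq (set X)) :=
  [set s | [/\ (0 < size s)%N,
    forall i, (i < size s)%N -> open (nth set0 s i) /\ nth set0 s i !=set0 &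
    forall i, (i.+1 < size s)%N -> nth set0 s i.+1 `<=` nth set0 s i]].
Arguments partial_play X _ : clear implicits.

Lemma play_partial (X : topologicalType) (U : nat -> set X) (n : nat) :
  play U -> mkseq U n.+1 \in partial_play X.
Proof.
move=> pU; apply/mem_set; split; rewrite size_mkseq// => i ltin.
  by rewrite nth_mkseq//; have [oU U0 _] := pU i.
by rewrite !nth_mkseq//; [have [_ _] := pU i | exact: ltnW].
Qed.

Definition initial (X : topologicalType) (U : nat -> set X) (pU : play U)
    (n : nat) : partial_play X :=
  exist _ (mkseq U n.+1) (play_partial n pU).

Definition II_wins (X Y : topologicalType) (f : X -> Y)
    (U : nat -> set X) (y : nat -> Y) : Prop :=
  ~ convergent U \/
  exists x, converges_to U x /\ y n @[n --> \oo] --> f x.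

(* Both sides are subtypes: only legal plays are in the domain, and for empty X
   the (empty) strategy exists even though range f has no point. *)
Definition II_strategy (X Y : topologicalType) (f : X -> Y) : Type :=
  partial_play X -> range f.

Definition II_winning (X Y : topologicalType) (f : X -> Y)
    (sigma : II_strategy f) : Prop :=
  forall (U : nat -> set X) (pU : play U),
    II_wins f U (fun n => val (sigma (initial pU n))).

(* Main.v *)
Require Import Defs.
From mathcomp Require Import all_boot all_order all_algebra.
From mathcomp Require Import all_classical all_reals all_analysis.
From mathcomp Require Import borel_hierarchy lra.
Set Implicit Arguments.
Unset Strict Implicit.
Unset Printing Implicit Defensive.
Import Order.TTheory GRing.Theory Num.Theory.
Local Open Scope classical_set_scope.
Local Open Scope ring_scope.

(** Suppose that [f] is Baire class 1.  Let [W_j] run through a countable basis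
    of [Y], each basic set repeated, so that closed sets [C_j] with
    [f(C_j) `<=` W_j] can be chosen in such a way that the preimage of a basic
    set is the union of the corresponding [C_j]
    ([Baire_class1_closed_cover]).  When [U_n] is played at round [n], Player II
    picks [J <= n + 1] as large as possible such that some [z] satisfies all
    constraints: [f z] is in [W_j] for each [j < J] with [C_j] meeting [U_n];
    the answer is [f z].  If the [U_n] converge to [x], then, the [C_j] being
    closed, for each fixed [J] and all large [n] the [C_j] with [j < J] that
    meet [U_n] are exactly those containing [x] ([converges_to_closed]).  Then
    [x] itself satisfies the first [J] constraints, hence so does the chosen
    [z].  The [W_j] with [x] in [C_j] form a local basis at [f x], so the
    answers converge to [f x] ([Baire_class1_II_winning]).

    Conversely, let Player II have a winning strategy, and let Player I only
    play finite intersections of sets from a countable basis [B] of [X]; a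
    position is then a finite list [l] of indices, with answer [g l].  Let [V]
    be open in [Y], exhausted by closed sets [F_k] whose interiors cover [V].
    A point [x] has its image in [V] if and only if there are [k] and a position
    [l] around [x] such that every extension [l ++ t] around [x] has its answer
    in [F_k].  Indeed, such an [l] can be extended to a run converging to [x],
    so that [f x], a limit of points of [F_k], is in [F_k].  If no such [l]
    exists for a [k] with [F_k] a neighborhood of [f x], then extending
    positions again and again gives a run that converges to [x] with infinitely
    many answers outside [F_k], so Player II loses.  For fixed [l] and [k] the
    condition defines the intersection of an open and a closed set, which is
    F-sigma since [X] is metrizable, and there are countably many pairs
    [(l, k)] ([Baire_class1_of_responses]). *)

(** * Metrizable and second countable spaces *)

(** The metric form of [metrizable] that the proofs use: the balls form
    neighborhood bases. *)
Lemma metrizable_nbhs (R : realType) (T : topologicalType) :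
  metrizable R T -> exists d : T -> T -> R, is_metric d /\
    forall x A, nbhs x A <-> exists2 e, 0 < e & [set y | d x y < e] `<=` A.
Proof.
move=> [d [dm dopen]]; exists d; split => // x A.
have [d_ge0 d_eq0 dC dtri] := dm; split.
  rewrite nbhsE => -[U [oU Ux] UA].
  have [e e0 eU] := (dopen U).1 oU x Ux.
  by exists e => //; apply: subset_trans UA.
move=> [e e0 eA]; apply: (filterS eA); apply: open_nbhs_nbhs; split; last first.
  by rewrite /= (d_eq0 x x).2.
apply/dopen => y /= xy; exists (e - d x y); first by rewrite subr_gt0.
move=> z /= yz; have := dtri x y z; lra.
Qed.

(** Countably many arbitrarily small positive radii. *)
Lemma vanishing_radii (R : realType) : exists r : nat -> R,
  (forall n, 0 < r n) /\ forall e, 0 < e -> exists n, r n < e.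
Proof.
exists (fun n => n.+1%:R^-1); split=> [n|e /ltr_add_invr[n]].
  by rewrite invr_gt0.
by rewrite add0r => ne; exists n.
Qed.

Lemma metrizable_separable_second_countable (R : realType)
    (T : topologicalType) :
  metrizable R T -> separable_space T -> second_countable (T := T).
Proof.
move=> /metrizable_nbhs[d [[d_ge0 d_eq0 dC dtri] nbhsP]] [D cD dD].
have [r [r0 rlt]] := vanishing_radii R.
pose ball_ (q : T) (n : nat) := [set y | d q y < r n].
have oball q n : open (ball_ q n).
  rewrite openE => y; rewrite /ball_ /= => qy; apply/nbhsP.
  exists (r n - d q y).
    by rewrite subr_gt0.
  by move=> z /= yz; have := dtri q y z; rewrite /ball_ /=; lra.
exists [set ball_ p.1 p.2 | p in D `*` [set: nat]].
  by apply: (card_le_trans (card_image_le _ _)); exact: countableX.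
split=> [_ [p _ <-]//|x A /nbhsP[e e0 eA]].
have /rlt[n ne] : 0 < e / 2 by rewrite divr_gt0.
have xball : ball_ x n x by rewrite /ball_ /= (d_eq0 x x).2.
have [q [xq Dq]] := dD (ball_ x n) (ex_intro _ x xball) (oball x n).
rewrite /ball_ /= in xq.
exists (ball_ q n); first by split; [exists (q, n)|rewrite /ball_ /= dC].
by move=> z; rewrite /ball_ /= => qz; apply: eA => /=; have := dtri x q z; lra.
Qed.

(** A countable basis can be listed as a sequence, also on the empty space:
    [setT] is added to the basis so that the range is nonempty. *)
Lemma second_countable_enum (T : topologicalType) :
  second_countable (T := T) -> exists B : nat -> set T,
    (forall n, open (B n)) /\
    forall x A, nbhs x A -> exists2 n, B n x & B n `<=` A.
Proof.
move=> [B cB [oB bB]].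
have : exists b : nat -> set T, range b = B `|` [set setT].
  have cB' : countable (B `|` [set setT]).
    rewrite -bigcup2E; apply: bigcup_countable => // i _.
    by case: i => [//|[|i]] /=; [exact: countable1|exact: countable0].
  have /pfcard_geP[B0|[b]] := cB'; last first.
    by exists b; exact: image_eq.
  by have : (B `|` [set setT]) setT by [right]; rewrite B0.
move=> [b bE]; exists b; split=> [n|x A /bB[U [BU Ux] UA]].
  have : (B `|` [set setT]) (b n) by rewrite -bE; exact: imageT.
  by case=> [/oB//|->]; exact: openT.
have : range b U by rewrite bE; left.
by move=> [n _ nU]; exists n; rewrite nU.
Qed.

(** The points of [V] at distance at least [r k] from the complement of [V],
    for arbitrarily small radii [r k], form the closed sets [F k]. *)
Lemma open_closed_exhaustion (R : realType) (T : topologicalType) (V : set T) :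
  metrizable R T -> open V -> exists F : nat -> set T,
    [/\ forall k, closed (F k), forall k, F k `<=` V &
        forall y, V y -> exists k, nbhs y (F k)].
Proof.
move=> /metrizable_nbhs[d [[d_ge0 d_eq0 dC dtri] nbhsP]] oV.
have [r [r0 rlt]] := vanishing_radii R.
exists (fun k => [set y | [set z | d y z < r k] `<=` V]); split.
- move=> k p clp z /= pz.
  have /clp[w [/= wV wz]] : nbhs p [set w | d w z < r k].
    apply/nbhsP; exists (r k - d p z); first by rewrite subr_gt0.
    by move=> w /= pw; have := dtri w p z; have := dC p w; lra.
  exact: wV.
- by move=> k y; apply => /=; rewrite (d_eq0 y y).2.
- move=> y Vy; have /nbhsP[e e0 eV] : nbhs y V by apply: open_nbhs_nbhs.
  have e20 : 0 < e / 2 by rewrite divr_gt0.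
  have [k ke] := rlt _ e20.
  exists k; apply/nbhsP; exists (e / 2) => // z /= yz w /= zw.
  by apply: eV => /=; have := dtri y z w; lra.
Qed.

Lemma Fsigma_bigcup (I : countType) (T : topologicalType) (A : I -> set T) :
  (forall i, Fsigma (A i)) -> Fsigma (\bigcup_i A i).
Proof.
move=> FA.
have /choice[F FP] : forall i, exists F : nat -> set T,
    (forall n, closed (F n)) /\ A i = \bigcup_n F n.
  by move=> i; have [F cF AE] := FA i; exists F.
exists (fun m => if unpickle m is Some p then F p.1 p.2 else set0).
  by move=> m; case: unpickle => [p|]; [have [] := FP p.1|exact: closed0].
apply/seteqP; split=> [x [i _]|x [m _]].
  rewrite (FP i).2 => -[n _ Fx]; exists (pickle (i, n)) => //.
  by rewrite pickleK.
case: unpickle => [[i n] /= Fx|//]; exists i => //.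
by rewrite (FP i).2; exists n.
Qed.

Lemma open_Fsigma (R : realType) (T : topologicalType) (V : set T) :
  metrizable R T -> open V -> Fsigma V.
Proof.
move=> mT oV; have [F [cF FV VF]] := open_closed_exhaustion mT oV.
exists F => //; apply/seteqP; split=> [x|x [k _ /FV]//].
by move=> /VF[k /nbhs_singleton Fx]; exists k.
Qed.

Lemma FsigmaI_closed (T : topologicalType) (A C : set T) :
  Fsigma A -> closed C -> Fsigma (A `&` C).
Proof.
move=> [F cF ->] cC; exists (fun n => F n `&` C) => [n|]; first exact: closedI.
by rewrite setI_bigcupl.
Qed.

Lemma converges_to_unique (R : realType) (X : topologicalType)
    (U : nat -> set X) (x y : X) :
  metrizable R X -> converges_to U x -> converges_to U y -> x = y.
Proof.
move=> /metrizable_nbhs[d [[d_ge0 d_eq0 dC dtri] nbhsP]].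
move=> [_ _ _ Ux] [_ _ Uy _]; apply/d_eq0; apply/eqP; rewrite eq_le d_ge0 andbT.
apply/ler_addgt0Pl => e e0; rewrite addr0.
have : nbhs x [set z | d x z < e] by apply/nbhsP; exists e.
rewrite nbhsE => -[V [oV Vx] Ve].
have [n UV] := Ux V oV Vx.
exact/ltW/Ve/UV/Uy.
Qed.

(** * A winning strategy from Baire class 1 *)

(** The index [j] encodes a pair [(m, k)]: [W j] is the [m]-th basic set of [Y]
    and [C j] is the [k]-th closed set in the union that makes up its
    preimage. *)
Lemma Baire_class1_closed_cover (X Y : topologicalType) (f : X -> Y) :
  second_countable (T := Y) -> Baire_class1 f ->
  exists (C : nat -> set X) (W : nat -> set Y),
    [/\ forall j, closed (C j), forall j, C j `<=` f @^-1` W j &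
        forall x V, nbhs (f x) V -> exists2 j, C j x & W j `<=` V].
Proof.
move=> /second_countable_enum[B [oB bB]] fB.
have /choice[F FP] : forall m, exists F : nat -> set X,
    (forall k, closed (F k)) /\ f @^-1` B m = \bigcup_k F k.
  by move=> m; have [F cF AE] := fB _ (oB m); exists F.
pose u j : nat * nat := odflt (0, 0)%N (unpickle j).
exists (fun j => F (u j).1 (u j).2), (fun j => B (u j).1); split.
- by move=> j; have [] := FP (u j).1.
- by move=> j x Fx; rewrite (FP (u j).1).2; exists (u j).2.
- move=> x V /bB[m Bm mV].
  have : (f @^-1` B m) x by [].
  rewrite (FP m).2 => -[k _ Fx].
  by exists (pickle (m, k)); rewrite /u pickleK.
Qed.

Lemma decreasing_sets_le (T : Type) (A : nat -> set T) i j :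
  (forall n, A n.+1 `<=` A n) -> (i <= j)%N -> A j `<=` A i.
Proof.
move=> Adec /subnK<-; elim: (j - i)%N => [//|m IH].
by rewrite addSn; apply: subset_trans (Adec _) IH.
Qed.

(** If finitely many sets of a decreasing sequence are considered, a point of
    the last nonempty one lies in every nonempty one.  This chooses an answer
    of Player II that meets as many constraints as possible. *)
Lemma point_of_largest_nonempty (T : Type) (A : nat -> set T) (t0 : T) n :
  (forall i, A i.+1 `<=` A i) ->
  exists z, forall i, (i <= n)%N -> A i !=set0 -> A i z.
Proof.
move=> Adec.
have Ale := decreasing_sets_le Adec.
elim: n => [|n [z IH]].
  have [[z Az]|A0] := pselect (A 0%N !=set0); last first.
    by exists t0 => i; rewrite leqn0 => /eqP->.
  by exists z => i; rewrite leqn0 => /eqP->.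
have [[z' Az]|A0] := pselect (A n.+1 !=set0).
  by exists z' => i /Ale ile _; exact: ile.
exists z => i; rewrite leq_eqVlt => /predU1P[->//|]; exact: IH.
Qed.

(** Along open sets converging to [x], only the closed sets that contain [x] are
    met forever; uniformly for finitely many closed sets. *)
Lemma converges_to_closed (X : topologicalType) (U : nat -> set X) (x : X)
    (C : nat -> set X) (J : nat) :
  converges_to U x -> (forall j, closed (C j)) ->
  exists N, forall n, (N <= n)%N ->
    forall j, (j < J)%N -> C j `&` U n !=set0 -> C j x.
Proof.
move=> [_ Udec Ux Ub] cC.
have Ule := decreasing_sets_le Udec.
elim: J => [|J [N IH]]; first by exists 0%N.
have [Cx|nCx] := pselect (C J x).
  exists N => n Nn j; rewrite ltnS leq_eqVlt => /predU1P[->//|]; exact: IH.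
have [M UM] := Ub _ (closed_openC (cC J)) nCx.
exists (maxn N M) => n; rewrite geq_max => /andP[Nn Mn] j.
rewrite ltnS leq_eqVlt => /predU1P[->|]; last exact: IH.
by move=> [z [Cz /(Ule _ _ Mn)/UM]].
Qed.

Lemma Baire_class1_II_winning (X Y : topologicalType) (f : X -> Y) :
  second_countable (T := Y) -> Baire_class1 f ->
  exists sigma : II_strategy f, II_winning sigma.
Proof.
move=> scY /(Baire_class1_closed_cover scY)[C [W [cC CW fW]]].
(* A U J: the points whose image satisfies the first J constraints at U. *)
pose A (U : set X) J :=
  [set z | forall j, (j < J)%N -> C j `&` U !=set0 -> W j (f z)].
have /choice[h hP] : forall s : partial_play X, exists z,
    forall J, (J <= size (val s))%N ->
      A (last set0 (val s)) J !=set0 -> A (last set0 (val s)) J z.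
  move=> [s /= /set_mem [s0 sne _]]; have [_ [x0 _]] := sne _ s0.
  apply: (point_of_largest_nonempty x0) => i z Az j ji.
  by apply: Az; rewrite ltnS ltnW.
exists (fun s => exist _ (f (h s)) (mem_set (imageT f (h s)))) => U pU.
have [[x Ux]|nU] := pselect (convergent U); last by left.
right; exists x; split => // V /fW[j Cx WV].
have [N NP] := converges_to_closed j.+1 Ux cC.
exists (maxn N j) => // n /=; rewrite geq_max => /andP[Nn jn].
apply: WV; have := hP (initial pU n) j.+1.
have -> : val (initial pU n) = mkseq U n.+1 by [].
rewrite size_mkseq mkseqS last_rcons ltnS => /(_ jn).
have [_ _ Unx _] := Ux.
apply=> //; last by exists x.
by exists x => i ij /(NP n Nn i ij) /CW.
Qed.

(** * Baire class 1 from a winning strategy *)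

(** The open set coded by the list [l] of indices: the intersection of the [B i]
    for [i] in [l], which is the whole space when [l] is empty. *)
Definition basic_cap (X : topologicalType) (B : nat -> set X) (l : seq nat) :
  set X := [set x | forall i, i \in l -> B i x].

Lemma open_basic_cap (X : topologicalType) (B : nat -> set X) l :
  (forall n, open (B n)) -> open (basic_cap B l).
Proof.
move=> oB; elim: l => [|i l IH].
  suff -> : basic_cap B [::] = setT by exact: openT.
  by apply/seteqP; split.
suff -> : basic_cap B (i :: l) = B i `&` basic_cap B l by exact: openI.
apply/seteqP; split=> [x Bx|x [Bi Bl] j].
  by split=> [|j jl]; apply: Bx; rewrite inE ?eqxx ?jl ?orbT.
by rewrite inE => /predU1P[->//|/Bl].
Qed.

Lemma basic_cap_cat (X : topologicalType) (B : nat -> set X) l t :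
  basic_cap B (l ++ t) = basic_cap B l `&` basic_cap B t.
Proof.
apply/seteqP; split=> [x Bx|x [Bl Bt] j].
  by split=> j jl; apply: Bx; rewrite mem_cat jl ?orbT.
by rewrite mem_cat => /orP[/Bl|/Bt].
Qed.

(** A sequence of indices running through all basic neighborhoods of [x]. *)
Lemma local_basis_enum (X : topologicalType) (B : nat -> set X) (x : X) :
  (forall A, nbhs x A -> exists2 n, B n x & B n `<=` A) ->
  exists b : nat -> nat, (forall n, B (b n) x) /\
    forall A, nbhs x A -> exists n, B (b n) `<=` A.
Proof.
move=> bB; have [n0 Bn0 _] := bB _ filterT.
(* The indices of the sets missing x are replaced by n0. *)
exists (fun n => if `[< B n x >] then n else n0); split=> [n|A /bB[n Bn nA]].
  by case: asboolP.
by exists n; rewrite asboolT.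
Qed.

(** A chain of longer and longer lists, each a prefix of the next one, consists
    of initial segments of one sequence. *)
Lemma limit_of_lists (L : nat -> seq nat) :
  (forall n, prefix (L n) (L n.+1)) -> (forall n, (n <= size (L n))%N) ->
  exists a : nat -> nat, forall n, mkseq a (size (L n)) = L n.
Proof.
move=> Lpre Lsize.
have Lle n m : (n <= m)%N -> prefix (L n) (L m).
  move=> /subnK<-; elim: (m - n)%N => [|i IH]; first exact: prefix_refl.
  by rewrite addSn; apply: (prefix_trans IH).
have Lnth n m i : (n <= m)%N -> (i < size (L n))%N ->
    nth 0%N (L n) i = nth 0%N (L m) i.
  by move=> /Lle/prefixP[s ->] ilt; rewrite nth_cat ilt.
exists (fun i => nth 0%N (L i.+1) i) => n.
apply: (@eq_from_nth _ 0%N); rewrite size_mkseq// => i ilt.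
rewrite nth_mkseq//; have [/Lnth|/ltnW/Lnth] := leqP i.+1 n.
  by apply; exact: Lsize.
by move=> <-.
Qed.

(** [g l] stands for the answer of Player II when the intersections of the
    nonempty initial segments of [l] have been played.  The answers [g] only
    have to converge to [f x] along the index sequences whose basic sets contain
    [x] and get arbitrarily small around it. *)
Lemma Baire_class1_of_responses (R : realType) (X Y : topologicalType)
    (f : X -> Y) (B : nat -> set X) (g : seq nat -> Y) :
  metrizable R X -> metrizable R Y ->
  (forall n, open (B n)) ->
  (forall x A, nbhs x A -> exists2 n, B n x & B n `<=` A) ->
  (forall x (a : nat -> nat), (forall n, B (a n) x) ->
    (forall A, nbhs x A -> exists n, B (a n) `<=` A) ->
    g (mkseq a n.+1) @[n --> \oo] --> f x) ->
  Baire_class1 f.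
Proof.
move=> mX mY oB bB gP V oV.
have [F [cF FV VF]] := open_closed_exhaustion mY oV.
pose S (p : seq nat * nat) := basic_cap B p.1 `&`
  \bigcap_(t in [set t | ~ F p.2 (g (p.1 ++ t))]) ~` basic_cap B t.
suff -> : f @^-1` V = \bigcup_p S p.
  apply: Fsigma_bigcup => p; apply: FsigmaI_closed.
    by apply: (open_Fsigma mX); exact: open_basic_cap.
  apply: closed_bigI => t _; apply: open_closedC; exact: open_basic_cap.
apply/seteqP; split=> x; last first.
  move=> [[l k] _ [/= Bl Ft]]; apply: (FV k).
  have [b [bx bA]] := local_basis_enum (bB x).
  (* The run: the position l, followed by all basic neighborhoods of x. *)
  pose a i := if (i < size l)%N then nth 0%N l i else b (i - size l)%N.
  have aE m : mkseq a (size l + m) = l ++ mkseq b m.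
    apply: (@eq_from_nth _ 0%N); rewrite ?size_cat !size_mkseq// => i ilt.
    rewrite nth_mkseq// nth_cat /a; case: ltnP => // li.
    by rewrite nth_mkseq// ltn_subLR.
  have ax n : B (a n) x.
    by rewrite /a; case: ltnP => // nl; apply: Bl; exact: mem_nth.
  have /gP : forall A, nbhs x A -> exists n, B (a n) `<=` A.
    move=> A /bA[n nA]; exists (size l + n)%N.
    by rewrite /a ltnNge leq_addr/= addKn.
  move=> /(_ ax) ga; apply: (closed_cvg (F k) (cF k) _ _ ga).
  exists (size l) => // n /= ln; rewrite -(subnKC (leqW ln)) aE.
  apply: contrapT => /Ft; apply => i /mapP[j _ ->]; exact: bx.
(* If no position works for k, then each position l around x has an extension
   l ++ e l around x with an answer outside F k. *)
move=> /VF[k kF]; apply: contrapT => nS.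
have /choice[e eP] : forall l, exists t, basic_cap B l x ->
    basic_cap B t x /\ ~ F k (g (l ++ t)).
  move=> l; apply: contrapT => /forallNP nt; apply: nS.
  have lx : basic_cap B l x by apply: contrapT => nlx; apply: (nt [::]).
  exists (l, k) => //; split => //= t Ft tx; exact: (nt t).
have [b [bx bA]] := local_basis_enum (bB x).
(* Between two such extensions a basic neighborhood b m of x is played, which
   makes the run converge to x. *)
pose L := fix L n := if n is m.+1 then
  let s := rcons (L m) (b m) in s ++ e s else [::].
have LS n : L n.+1 = rcons (L n) (b n) ++ e (rcons (L n) (b n)) by [].
have rx l n : basic_cap B l x -> basic_cap B (rcons l (b n)) x.
  by move=> lx i; rewrite mem_rcons inE => /predU1P[->//|/lx].
have Lx n : basic_cap B (L n) x.
  elim: n => [//|n IH]; rewrite LS basic_cap_cat; split; first exact: rx.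
  exact: (eP _ (rx _ _ IH)).1.
have Lsize n : (n <= size (L n))%N.
  elim: n => // n IH; rewrite LS size_cat size_rcons.
  by rewrite (leq_trans _ (leq_addr _ _)).
have [a aE] : exists a : nat -> nat, forall n, mkseq a (size (L n)) = L n.
  apply: limit_of_lists => // n.
  by rewrite LS -cats1 -catA; exact: prefix_prefix.
have /gP : forall n, B (a n) x.
  by move=> n; apply: (Lx n.+1); rewrite -aE; apply: map_f; rewrite mem_iota /=.
have : forall A, nbhs x A -> exists n, B (a n) `<=` A.
  move=> A /bA[n nA].
  have : b n \in L n.+1 by rewrite LS mem_cat mem_rcons mem_head.
  by rewrite -aE => /mapP[i _ bE]; exists i; rewrite -bE.
move=> aA /(_ aA) /(_ _ kF)[N _ NP].
have LN : (0 < size (L N.+1))%N by apply: leq_trans (Lsize N.+1).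
apply: (eP _ (rx _ N (Lx N))).2; rewrite -LS -aE -(prednK LN).
by apply: NP => /=; rewrite -ltnS (prednK LN); exact: (Lsize N.+1).
Qed.

(** The moves of Player I coded by the index sequence [a]: at round [n] the
    intersection of [B (a 0)], ..., [B (a n)], which makes the moves
    decrease. *)
Definition basic_play (X : topologicalType) (B : nat -> set X)
  (a : nat -> nat) (n : nat) : set X := basic_cap B (mkseq a n.+1).

Lemma II_winning_Baire_class1 (R : realType) (X Y : topologicalType)
    (f : X -> Y) (sigma : II_strategy f) :
  metrizable R X -> second_countable (T := X) -> metrizable R Y ->
  II_winning sigma -> Baire_class1 f.
Proof.
move=> mX /second_countable_enum[B [oB bB]] mY win.
have [[x0 _]|X0] := pselect ([set: X] !=set0); last first.
  move=> V _; suff -> : f @^-1` V = set0 by apply/closed_Fsigma/closed0.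
  by apply/seteqP; split=> // x _; apply: X0; exists x.
(* s l is the partial play coded by l; when it is not legal, its intersection
   being empty or l being empty, the value of g does not matter. *)
pose s l := mkseq (basic_play B (nth 0%N l)) (size l).
pose g l : Y := if pselect (s l \in partial_play X) is left p
  then val (sigma (exist _ (s l) p)) else f x0.
apply: (Baire_class1_of_responses (B := B) (g := g) mX mY oB bB) => x a ax aA.
have Ux n : basic_play B a n x by move=> i /mapP[j _ ->].
have oU n : open (basic_play B a n) by exact: open_basic_cap.
have Udec n : basic_play B a n.+1 `<=` basic_play B a n.
  by rewrite /basic_play [mkseq a n.+2]mkseqS -cats1 basic_cap_cat => z [].
have pU : play (basic_play B a) by move=> n; split => //; exists x.
have Ucvg : converges_to (basic_play B a) x.
  split=> // V oV Vx; have /aA[n nV] : nbhs x V by apply: open_nbhs_nbhs.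
  exists n => z Uz; apply/nV/Uz; apply: map_f.
  by rewrite mem_iota /= ltnS.
have [nU|[x' [Ux' gx']]] := win _ pU; first by exfalso; apply: nU; exists x.
rewrite (converges_to_unique mX Ucvg Ux').
suff -> : (fun n => g (mkseq a n.+1)) =
    (fun n => val (sigma (initial pU n))) by [].
apply/funext => n.
have sE : s (mkseq a n.+1) = mkseq (basic_play B a) n.+1.
  rewrite /s size_mkseq; apply/eq_in_map => i; rewrite mem_iota /= => ilt.
  rewrite /basic_play; congr basic_cap; apply/eq_in_map => j.
  rewrite mem_iota /= => jlt; rewrite nth_mkseq//.
  exact: leq_trans jlt ilt.
rewrite /g; case: pselect => [p|]; last first.
  by rewrite sE; have := play_partial n pU.
by congr (val (sigma _)); apply: val_inj.
Qed.

Theorem theorem2p2 (R : realType) (X Y : topologicalType)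
    (mX : metrizable R X) (sX : separable_space X)
    (mY : metrizable R Y) (sY : separable_space Y) (f : X -> Y) :
  (exists sigma : II_strategy f, II_winning sigma) <-> Baire_class1 f.
Proof.
split=> [[sigma]|].
  apply: (II_winning_Baire_class1 mX _ mY).
  exact: metrizable_separable_second_countable mX sX.
apply: Baire_class1_II_winning.
exact: metrizable_separable_second_countable mY sY.
Qed.
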